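(* Let $n\geq 1$, and for even $k\geq 0$ let $C_{\mathbb{S}}(n,k)=\langle\operatorname{Tr}\mathbf{x}^k\rangle_{\mathbb{S}}$ be the expectation on the spin factor $\mathbb{S}=\mathbb{S}_{1,n}$ (with $C_{\mathbb{S}}(n,0)=1$). Define the formal power series $$B(x)=\sum_{m\ge0}\frac{C_{\mathbb{S}}(n,2m)}{2^m m!}\,x^{2m},\qquad B_c(x)=\log B(x).$$ Then $$B_c(x)=\sum_{m\ge1}\frac{1}{2m}\big((2^m-1)n+1\big)x^{2m}.$$
   Context: **Spin factor.** $\mathbb{S}_{1,n}$ is the real vector space $\mathbb{R}\times\mathbb{R}^n$, with elements $\mathbf{x}=(x_0,x)$, and product $\mathbf{x}\bullet\mathbf{y}=(x_0y_0+x\cdot y,\;x_0y+y_0x)$, where $\cdot$ is the Euclidean dot product. The trace is $\operatorname{Tr}(\mathbf{x})=x_0$. Powers: $\mathbf{x}^1=\mathbf{x}$, $\mathbf{x}^k=\mathbf{x}\bullet\mathbf{x}^{k-1}$ for $k>1$. For a polynomial function $h$ on $\mathbb{S}$, $\langle h\rangle_{\mathbb{S}}=\int_{\mathbb{S}}h(\mathbf{x})e^{-\operatorname{Tr}(\mathbf{x}^2)/2}d\mathbf{x}\Big/\int_{\mathbb{S}}e^{-\operatorname{Tr}(\mathbf{x}^2)/2}d\mathbf{x}$, with Lebesgue measure. For fixed even $k$, $C_{\mathbb{S}}(n,k)$ is a polynomial in $n$; for example $C_{\mathbb{S}}(n,2)=n+1$ and $C_{\mathbb{S}}(n,4)=n^2+8n+3$.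 *)

(* Defs.v *)
From HB Require Import structures.
From mathcomp Require Import all_boot all_order all_algebra.
From mathcomp Require Import all_classical all_reals all_analysis.

Set Implicit Arguments.
Unset Strict Implicit.
Unset Printing Implicit Defensive.

Import Order.TTheory GRing.Theory Num.Theory.
Import numFieldNormedType.Exports.
Local Open Scope classical_set_scope.
Local Open Scope ring_scope.

Lemma sigma_finite_product d1 d2 (T1 : measurableType d1)
    (T2 : measurableType d2) (R : realType)
    (m1 : {sigma_finite_measure set T1 -> \bar R})
    (m2 : {sigma_finite_measure set T2 -> \bar R}) :
  sigma_finite setT (m1 \x m2)%E.
Proof.
have /sigma_finiteP[F [TF ndF Foo]] := sigma_finiteT m1.
have /sigma_finiteP[G [TG ndG Goo]] := sigma_finiteT m2.
exists (fun n => F n `*` G n).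
  rewrite -setXTT TF TG predeqE => -[x y]; split.
    move=> [/= [n _ Fnx] [k _ Gky]]; exists (maxn n k) => //; split.
    - by move: x Fnx; exact/subsetPset/ndF/leq_maxl.
    - by move: y Gky; exact/subsetPset/ndG/leq_maxr.
  by move=> [n _ []/= ? ?]; split; exists n.
move=> k; have [? ?] := Foo k; have [? ?] := Goo k.
split; first exact: measurableX.
by rewrite product_measure1E// lte_mul_pinfty// ge0_fin_numE.
Qed.

(* Lebesgue measure on R^n, carried by the measurable type of n-tuples. *)
Section LebesgueTuple.
Context (R : realType).
Local Notation mR := (measurableTypeR R).

Definition tuple_cons (n : nat) (z : mR * n.-tuple mR) : n.+1.-tuple mR :=
  [tuple of z.1 :: z.2].

Lemma measurable_tuple_cons (n : nat) : measurable_fun setT (@tuple_cons n).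
Proof. exact: measurable_cons. Qed.

Section Step.
Context (n : nat) (m : {sigma_finite_measure set (n.-tuple mR) -> \bar R}).

Definition lebesgue_tupleS : set (n.+1.-tuple mR) -> \bar R :=
  pushforward (@lebesgue_measure R \x m)%E (@tuple_cons n).

Let leb0 : lebesgue_tupleS set0 = 0%E.
Proof. by rewrite /lebesgue_tupleS /pushforward preimage_set0 measure0. Qed.

Let leb_ge0 A : (0 <= lebesgue_tupleS A)%E.
Proof. by rewrite /lebesgue_tupleS /pushforward measure_ge0. Qed.

Let leb_sigma_additive : semi_sigma_additive lebesgue_tupleS.
Proof.
have mp A : measurable A -> measurable (@tuple_cons n @^-1` A).
  by move=> mA; rewrite -[X in measurable X]setTI; exact: measurable_tuple_cons.
move=> F mF tF mUF; rewrite /lebesgue_tupleS /pushforward preimage_bigcup.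
apply: measure_semi_sigma_additive.
- by move=> k; exact: mp.
- apply/trivIsetP => /= i j _ _ ij; rewrite -preimage_setI.
  by move/trivIsetP : tF => /(_ _ _ _ _ ij) ->//; rewrite preimage_set0.
- by rewrite -preimage_bigcup; exact: mp.
Qed.

HB.instance Definition _ := isMeasure.Build _ _ _
  lebesgue_tupleS leb0 leb_ge0 leb_sigma_additive.

Let leb_sigma_finite : sigma_finite setT lebesgue_tupleS.
Proof.
have [F FT Foo] := sigma_finite_product (@lebesgue_measure R) m.
pose u := fun t : n.+1.-tuple mR =>
  (tnth t ord0, [tuple of behead t]) : mR * n.-tuple mR.
have mu : measurable_fun setT u.
  apply/measurable_fun_pairP; split; first exact: measurable_tnth.
  exact: measurable_behead.
exists (fun k => u @^-1` F k).
  by rewrite -preimage_bigcup -FT preimage_setT.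
move=> k; have [mF Fk] := Foo k; split.
  by rewrite -[X in measurable X]setTI; exact: mu.
rewrite /lebesgue_tupleS /pushforward (_ : _ @^-1` _ = F k)//.
have uK z : u (tuple_cons z) = z.
  by case: z => a t; congr pair; apply: val_inj.
by apply/seteqP; split => z /=; rewrite uK.
Qed.

HB.instance Definition _ :=
  Measure_isSigmaFinite.Build _ _ _ lebesgue_tupleS leb_sigma_finite.
End Step.

Fixpoint lebesgue_tuple (n : nat) :
    {sigma_finite_measure set (n.-tuple mR) -> \bar R} :=
  if n is n'.+1 then lebesgue_tupleS (lebesgue_tuple n')
  else \d_([tuple] : 0.-tuple mR).

Lemma lebesgue_tuple_box (n : nat) (A : 'I_n -> set mR) :
  (forall i, measurable (A i)) ->
  lebesgue_tuple n [set t | forall i, A i (tnth t i)]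
    = (\prod_(i < n) @lebesgue_measure R (A i))%E.
Proof.
elim: n A => [|n IH] A mA.
  rewrite big_ord0 /= diracE mem_set//.
  by move=> [].
rewrite big_ord_recl /= -IH// /lebesgue_tupleS /pushforward.
rewrite -product_measure1E//; last first.
  rewrite (_ : [set t | _] =
    \bigcap_(i in [set: 'I_n]) (fun t => tnth t i) @^-1` A (lift ord0 i)).
    apply: fin_bigcap_measurable => // i _.
    by rewrite -[X in measurable X]setTI; exact: measurable_tnth.
  by apply/seteqP; split => t /= h i; [move=> _; exact: h | exact: h].
congr (_ _); apply/seteqP; split => -[a t] /=.
- move=> h; split=> [|i]; first exact: (h ord0).
  by have := h (lift ord0 i); rewrite /tuple_cons tnthS.
- move=> [ha ht] i; case: (unliftP ord0 i) => [j ->|->] //.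
  by rewrite /tuple_cons tnthS; exact: ht.
Qed.
End LebesgueTuple.

Section SpinFactor.
Context (R : realType) (n : nat).

Definition spin : lmodType R := (R^o * 'rV[R]_n)%type.

Implicit Types x y : spin.

Definition dot (u v : 'rV[R]_n) : R := \sum_(i < n) u 0 i * v 0 i.

Definition spin_mul x y : spin :=
  (x.1 * y.1 + dot x.2 y.2, x.1 *: y.2 + y.1 *: x.2).

Definition spin_one : spin := (1, 0).

Definition spin_tr x : R := x.1.

(* iterop gives x^1 = x and x^(k+1) = x * x^k for k > 0 by conversion; x^0 is
   taken to be the identity of the product. *)
Definition spin_exp x (k : nat) : spin := iterop k spin_mul x spin_one.

Lemma spin_mul1x x : spin_mul spin_one x = x.
Proof.
case: x => a u; rewrite /spin_mul /= mul1r scale1r scaler0 addr0.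
by rewrite /dot big1 ?addr0// => i _; rewrite mxE mul0r.
Qed.

Lemma spin_mulC x y : spin_mul x y = spin_mul y x.
Proof.
rewrite /spin_mul mulrC addrC [in RHS]addrC; congr pair; last by rewrite addrC.
by congr (_ + _); apply: eq_bigr => i _; rewrite mulrC.
Qed.

Definition spin_coord (z : measurableTypeR R * n.-tuple (measurableTypeR R)) :
  spin := (z.1, \row_(i < n) tnth z.2 i).

Definition spin_lebesgue :=
  (@lebesgue_measure R \x lebesgue_tuple R n)%E.

Definition spin_integral (h : spin -> R) : R :=
  \int[spin_lebesgue]_z h (spin_coord z).

Definition spin_weight x : R := expR (- (spin_tr (spin_exp x 2) / 2)).

Definition spin_mean (h : spin -> R) : R :=
  spin_integral (fun x => h x * spin_weight x) / spin_integral spin_weight.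

Definition spin_C (k : nat) : R := spin_mean (fun x => spin_tr (spin_exp x k)).
End SpinFactor.

(* A formal power series is its coefficient sequence. *)
Section FormalPowerSeries.
Context (R : fieldType).
Implicit Types a b : nat -> R.

Definition fps_one : nat -> R := fun k => (k == 0)%:R.

Definition fps_sub a b : nat -> R := fun k => a k - b k.

Definition fps_mul a b : nat -> R :=
  fun k => \sum_(i < k.+1) a i * b (k - i)%N.

Definition fps_exp a (j : nat) : nat -> R := iter j (fps_mul a) fps_one.

(* log a = \sum_(j >= 1) (-1)^(j+1) / j * (a - 1)^j, for a with constant
   coefficient 1: then (a - 1)^j has no term of degree k < j, so the
   coefficient of degree k is a finite sum. *)
Definition fps_log a : nat -> R :=
  fun k => \sum_(1 <= j < k.+1)
    (-1) ^+ j.+1 / j%:R * fps_exp (fps_sub a fps_one) j k.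

(* \sum_(m >= 0) c m * x^(2m) *)
Definition fps_even (c : nat -> R) : nat -> R :=
  fun k => if odd k then 0 else c k./2.
End FormalPowerSeries.

Definition spin_B (R : realType) (n : nat) : nat -> R :=
  fps_even (fun m => spin_C R n m.*2 / (2 ^+ m * m`!%:R)).

Definition spin_Bc (R : realType) (n : nat) : nat -> R := fps_log (spin_B R n).

(* Main.v *)
(* Writing x = (x_0, v), r = |v| and x^k = (A_k, B_k v), one has
   A_k + r B_k = (x_0 + r)^k and A_k - r B_k = (x_0 - r)^k, so that the
   trace of x^(2m) is the even part of (x_0 + r)^(2m).  The even moments of x_0
   and r under the Gaussian weight are rising factorials (of step 2) of 1 and n,
   so that B, as a series in the square y of its variable, has the coefficients
     c_m = (1/2)_m / m! * sum_j C(m, j) (n/2)_j / (1/2)_j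
   of (1 - 2y)^(-n/2) (1 - y)^((n-1)/2).  The binomial transform turns the
   two-term recurrence of (n/2)_j / (1/2)_j into a three-term one for c_m, which
   determines the logarithmic derivative of B. *)
Require Import Defs.
From mathcomp Require Import all_boot all_order all_algebra.
From mathcomp Require Import all_classical all_reals all_analysis.
From mathcomp Require Import measurable_realfun ring.

Set Implicit Arguments.
Unset Strict Implicit.
Unset Printing Implicit Defensive.

Import Order.TTheory GRing.Theory Num.Theory.
Local Open Scope ring_scope.

(** * The formal logarithm through its differential equation *)

Section FpsLog.
Context (R : numFieldType).
Implicit Types a L : nat -> R.

(** Truncation at degree [k] leaves lower coefficients of powers intact, so series identities can be
    proved in [{poly R}], where derivatives are available. *)
Lemma fps_exp_coef a (k j i : nat) : (i < k)%N ->
  fps_exp a j i = ((\poly_(l < k) a l) ^+ j)`_i.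
Proof.
elim: j i => [|j IH] i ik; first by rewrite expr0 coef1.
rewrite exprS coefM /fps_exp iterS -/(fps_exp a j) /fps_mul.
apply: eq_bigr => l _; rewrite coef_poly (leq_ltn_trans _ ik) ?leq_ord//.
by rewrite IH// (leq_ltn_trans _ ik)// leq_subr.
Qed.

Lemma coef_expr_lt (p : {poly R}) (j i : nat) :
  p`_0 = 0 -> (i < j)%N -> (p ^+ j)`_i = 0.
Proof.
move=> p0; have -> : p = drop_poly 1 p * 'X.
  have := poly_take_drop 1 p; rewrite expr1 => {1}<-.
  rewrite (_ : take_poly 1 p = 0) ?add0r//.
  by apply/polyP => l; rewrite coef_take_poly coef0; case: l.
by move=> ij; rewrite exprMn_comm ?coefMXn ?ij//; exact: commr_polyX.
Qed.

(* The identity a * (log a)' = a', read off coefficientwise. *)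
Lemma fps_log_deriv a (k : nat) : a 0%N = 1 ->
  \sum_(i < k) a i * ((k - i)%:R * fps_log a (k - i)) = k%:R * a k.
Proof.
move=> a0; case: k => [|k]; first by rewrite big_ord0 mul0r.
(* Differentiation moves degree [k.+1] to degree [k], hence the bound [k.+2]. *)
pose p := \poly_(l < k.+2) fps_sub a (@fps_one R) l.
have p0 : p`_0 = 0 by rewrite coef_poly /fps_sub /fps_one /= a0 subrr.
pose l := \sum_(1 <= j < k.+2) ((-1) ^+ j.+1 / j%:R) *: p ^+ j.
have lE i : (i < k.+2)%N -> l`_i = fps_log a i.
  move=> ik; rewrite /l coef_sum (@big_cat_nat _ _ _ i.+1)//=.
  rewrite [X in _ + X]big_nat [X in _ + X]big1 ?addr0; last first.
    by move=> j /andP[ij _]; rewrite coefZ coef_expr_lt// mulr0.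
  rewrite /fps_log; apply: eq_bigr => j _.
  by rewrite coefZ (@fps_exp_coef _ k.+2).
(* The derivative of [l] is that of [p] times a geometric sum in [- p], which [1 + p] telescopes;
   the remainder [(- p) ^+ k.+1] has no term of degree [k] or less. *)
have dl : (1 + p) * l^`() = p^`() * (1 - (- p) ^+ k.+1).
  rewrite -opprB subrX1 -mulNr opprB opprK mulrCA; congr (_ * _).
  rewrite /l raddf_sum /= big_add1 /= big_mkord mulr_sumr.
  apply: eq_bigr => j _; rewrite derivZ deriv_exp.
  have j0 : j.+1%:R != 0 :> R by rewrite pnatr_eq0.
  rewrite -scaler_nat scalerA divfK// -(scaleN1r p) exprZn -scalerAr.
  by rewrite !exprS !mulN1r opprK.
have := congr1 (fun q : {poly R} => q`_k) dl.
rewrite mulrBr mulr1 coefB [X in _ - X](_ : _ = 0) ?subr0; last first.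
  rewrite coefM big1// => i _; rewrite coef_expr_lt ?mulr0 ?coefN ?p0 ?oppr0//.
  by rewrite ltnS leq_subr.
rewrite coefM coef_deriv coef_poly ltnSn /fps_sub /fps_one subr0.
rewrite mulr_natl => <-; apply: eq_bigr => i _.
rewrite coefD coef1 coef_poly coef_deriv.
have ik : (i < k.+2)%N by rewrite ltnW// ltnS.
rewrite ik /fps_sub /fps_one addrC subrK subSn ?leq_ord//.
by rewrite lE ?ltnS ?leq_subr// mulr_natl.
Qed.

(** As [a 0 = 1], for [k > 0] the equation of index [k] is [k%:R * L k] plus terms in earlier values
    of [L], so in characteristic zero it fixes [L k]. *)
Lemma fps_log_unique a L : a 0%N = 1 -> L 0%N = 0 ->
  (forall k, \sum_(i < k) a i * ((k - i)%:R * L (k - i)%N) = k%:R * a k) ->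
  fps_log a =1 L.
Proof.
move=> a0 L0 aL k; elim/ltn_ind: k => -[_|k IH].
  by rewrite /fps_log big_geq ?L0.
have := fps_log_deriv k.+1 a0; rewrite -aL !big_ord_recl /= !subn0 a0 !mul1r.
rewrite (eq_bigr (fun i : 'I_k => a (bump 0 i) *
   ((k.+1 - bump 0 i)%:R * L (k.+1 - bump 0 i)%N))); last first.
  by move=> i _; rewrite IH// /bump /= add1n subSS ltnS leq_subr.
by move=> /addIr /mulfI; apply; rewrite pnatr_eq0.
Qed.

Lemma sum_double (f : nat -> R) (m : nat) :
  \sum_(i < m.*2) f i = \sum_(i < m) (f i.*2 + f i.*2.+1).
Proof.
elim: m => [|m IH]; first by rewrite !big_ord0.
by rewrite doubleS !big_ord_recr /= IH -addrA.
Qed.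

(** In odd degree each product has a factor of odd index; in degree [2m] the equation is twice that
    of index [m]. *)
Lemma fps_log_even (b L : nat -> R) : b 0%N = 1 -> L 0%N = 0 ->
  (forall m, \sum_(i < m) b i * ((m - i)%:R * L (m - i)%N) = m%:R * b m) ->
  fps_log (fps_even b) =1 fps_even L.
Proof.
move=> b0 L0 bL; apply: fps_log_unique; rewrite /fps_even//= => k.
have [ko|ke] := boolP (odd k).
  rewrite mulr0 big1// => i _; have [io|ie] := boolP (odd i); first by rewrite mul0r.
  by rewrite oddB 1?ltnW// ko (negbTE ie) !mulr0.
rewrite -(even_halfK ke) doubleK; set m := k./2.
rewrite (sum_double (fun i => (if odd i then 0 else b i./2) *
  ((m.*2 - i)%:R * (if odd (m.*2 - i) then 0 else L (m.*2 - i)./2)))).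
rewrite -muln2 natrM mulrAC -bL mulr_suml; apply: eq_bigr => i _.
rewrite /= odd_double /= mul0r addr0 muln2 -doubleB !odd_double !doubleK.
by rewrite -[(m - i).*2]muln2 natrM; ring.
Qed.
End FpsLog.

(** * The binomial transform and its effect on recurrences *)

Section BinomialTransform.
Context (R : comNzRingType).
Implicit Types q : nat -> R.

Definition btrans q (m : nat) : R := \sum_(j < m.+1) 'C(m, j)%:R * q j.

Lemma btrans_wide q (m k : nat) : (m <= k)%N ->
  btrans q m = \sum_(j < k.+1) 'C(m, j)%:R * q j.
Proof.
move=> mk; rewrite /btrans -!(big_mkord xpredT (fun j => 'C(m, j)%:R * q j)).
rewrite [RHS](@big_cat_nat _ _ _ m.+1)//= [X in _ + X]big_nat.
rewrite [X in _ + X]big1 ?addr0// => j /andP[mj _].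
by rewrite bin_small// mul0r.
Qed.

(** By Pascal's rule, shifting a sequence amounts to differencing its transform. *)
Lemma btrans_shift q (m : nat) :
  btrans q m.+1 - btrans q m = btrans (fun j => q j.+1) m.
Proof.
rewrite [in X in _ - X](@btrans_wide q m m.+1)// /btrans -sumrB big_ord_recl /=.
rewrite !bin0 subrr add0r; apply: eq_bigr => j _.
by rewrite /bump /= add1n binS natrD; ring.
Qed.

(** Absorption: [j.+1 * 'C(m.+1, j.+1) = m.+1 * 'C(m, j)]. *)
Lemma btrans_index q (m : nat) :
  btrans (fun j => j%:R * q j) m.+1 = m.+1%:R * (btrans q m.+1 - btrans q m).
Proof.
rewrite btrans_shift /btrans big_ord_recl /= mul0r mulr0 add0r mulr_sumr.
apply: eq_bigr => j _; rewrite /bump /= add1n !mulrA -!natrM.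
by rewrite (mulnC 'C(_, _)) -mul_bin_diag.
Qed.

(** The hypothesis is transformed at [m.+1]. A shift and a factor [j] each become a difference, so
    [j%:R * q j.+1] yields a second difference: hence three terms. *)
Lemma btrans_rec q (x : R) (m : nat) :
  (forall j, j.*2.+1%:R * q j.+1 = (x + j.*2%:R) * q j) ->
  m.*2.+3%:R * btrans q m.+2 =
    (x + (6 * m + 7)%:R) * btrans q m.+1 - (4 * m.+1)%:R * btrans q m.
Proof.
move=> qS.
have : btrans (fun j => q j.+1 + 2%:R * (j%:R * q j.+1)) m.+1 =
       btrans (fun j => x * q j + 2%:R * (j%:R * q j)) m.+1.
  apply: eq_bigr => j _; congr (_ * _).
  move: (qS j); rewrite -addn1 -muln2 natrD natrM => h.
  have -> : q j.+1 + 2%:R * (j%:R * q j.+1) = (j%:R * 2%:R + 1%:R) * q j.+1 by ring.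
  rewrite h.
  by ring.
have btD y z u v k : btrans (fun j => y * u j + z * v j) k = y * btrans u k + z * btrans v k.
  rewrite /btrans !mulr_sumr -big_split; apply: eq_bigr => j _ /=; ring.
rewrite btD (_ : btrans _ m.+1 =
    btrans (fun j => 1 * q j.+1 + 2%:R * (j%:R * q j.+1)) m.+1).
  rewrite btD !btrans_index -!btrans_shift.
  move=> h.
  have -> : m.*2.+3%:R = 2%:R * m%:R + 3%:R :> R.
    by rewrite -[m.*2.+3]addn3 -muln2 natrD natrM mulrC.
  rewrite (natrD _ (6 * m)) (natrM _ 6) (natrM _ 4); move: h; rewrite -!natr1 => h.
  by apply/subr0_eq; move/eqP: h; rewrite -subr_eq0 => /eqP <-; ring.
by apply: eq_bigr => j _; rewrite mul1r.
Qed.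
End BinomialTransform.

(** * Rising factorials of step two and the recurrence of the coefficients *)

Section Recurrences.
Context (R : numFieldType).

(** Equals [2^j (x/2)_j]; for [x = 1] it is the double factorial [(2j-1)!!]. *)
Definition rising2 (x : R) (j : nat) : R := \prod_(i < j) (x + i.*2%:R).

Lemma rising2S x j : rising2 x j.+1 = rising2 x j * (x + j.*2%:R).
Proof. exact: big_ord_recr. Qed.

Lemma rising2_gt0 x j : 0 < x -> 0 < rising2 x j.
Proof.
by move=> x0; apply: prodr_gt0 => i _; rewrite ltr_pwDl.
Qed.

(** A Vandermonde convolution; it later adds one coordinate to the moments of the squared norm. *)
Lemma rising2D x y j :
  rising2 (x + y) j =
    \sum_(i < j.+1) 'C(j, i)%:R * (rising2 x i * rising2 y (j - i)).
Proof.
elim: j => [|j IH].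
  by rewrite big_ord_recl big_ord0 /= bin0 /rising2 !big_ord0 !mulr1 addr0.
rewrite rising2S IH mulr_suml.
(* The new factor splits as [(x + 2i) + (y + 2(j - i))], each part extending one rising factorial;
   Pascal's rule then regroups. *)
transitivity (\sum_(i < j.+1) ('C(j, i)%:R * (rising2 x i.+1 * rising2 y (j - i))
    + 'C(j, i)%:R * (rising2 x i * rising2 y (j.+1 - i)))).
  apply: eq_bigr => i _; rewrite subSn ?leq_ord// !rising2S.
  have -> : j.*2%:R = i.*2%:R + (j - i).*2%:R :> R.
    by rewrite -natrD -doubleD subnKC ?leq_ord.
  by ring.
rewrite big_split /= [in RHS]big_ord_recl /= bin0 subn0.
under [in RHS]eq_bigr => i _ do
  rewrite /bump /= add1n binS natrD mulrDl subSS.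
rewrite [in RHS]big_split /= [RHS]addrA [RHS]addrC.
congr (_ + _).
rewrite big_ord_recl /= bin0 subn0 [in RHS]big_ord_recr /= bin_small//.
rewrite mul0r addr0; congr (_ + _).
Qed.

Lemma fact_double k : (k.*2)`!%:R = rising2 1 k * (2 ^+ k * k`!%:R).
Proof.
elim: k => [|k IH]; first by rewrite /rising2 big_ord0 expr0 !mulr1.
rewrite doubleS !factS !natrM IH rising2S exprS -!natr1 -muln2 natrM.
by ring.
Qed.

(** Brings the weights ['C(2m, 2j)] of an even part down to the weights ['C(m, j)] of [btrans]. *)
Lemma bin_double m j : (j <= m)%N ->
  'C(m.*2, j.*2)%:R * rising2 1 (m - j) * rising2 1 j = rising2 1 m * 'C(m, j)%:R.
Proof.
move=> jm; have f0 i : i`!%:R != 0 :> R by rewrite pnatr_eq0 -lt0n fact_gt0.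
have t0 i : 2 ^+ i != 0 :> R by rewrite expf_neq0// pnatr_eq0.
have h1 : 'C(m.*2, j.*2)%:R * ((j.*2)`!%:R * (m.*2 - j.*2)`!%:R) = (m.*2)`!%:R :> R.
  by rewrite -!natrM bin_fact// leq_double.
have h2 : 'C(m, j)%:R * (j`!%:R * (m - j)`!%:R) = m`!%:R :> R.
  by rewrite -!natrM bin_fact.
rewrite -doubleB !fact_double -h2 (_ : 2 ^+ m = 2 ^+ j * 2 ^+ (m - j)) in h1; last first.
  by rewrite -exprD subnKC.
have nz : (2 ^+ j * 2 ^+ (m - j)) * (j`!%:R * (m - j)`!%:R) != 0 :> R.
  by rewrite !mulf_neq0.
apply: (mulIf nz).
transitivity ('C(m.*2, j.*2)%:R *
   (rising2 1 j * (2 ^+ j * j`!%:R) *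
    (rising2 1 (m - j) * (2 ^+ (m - j) * (m - j)`!%:R)))).
  by ring.
by rewrite h1; ring.
Qed.

(* The differential equation (1 - 2y)(1 - y) b' = ((x + 1)/2 - y) b implies
   2 b' = (2x/(1 - 2y) - (x - 1)/(1 - y)) b. *)
Lemma log_deriv_of_recurrence (x : R) (b : nat -> R) :
  b 0%N = 1 -> 2 * b 1%N = x + 1 ->
  (forall m, (2 * m.+2)%:R * b m.+2 =
     (x + (6 * m + 7)%:R) * b m.+1 - (2 * m.*2.+1)%:R * b m) ->
  forall m, \sum_(i < m) b i * ((2 ^+ (m - i) - 1) * x + 1) = (2 * m)%:R * b m.
Proof.
move=> b0 b1 br.
(* The coefficients of [b] times [2y/(1 - 2y)] and of [b] times [y/(1 - y)]. *)
pose U m := \sum_(i < m) b i * 2 ^+ (m - i); pose V m := \sum_(i < m) b i.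
have US m : U m.+1 = 2 * U m + 2 * b m.
  rewrite /U big_ord_recr /= subSnn expr1 mulr_sumr; congr (_ + _); last exact: mulrC.
  by apply: eq_bigr => i _; rewrite subSn ?(ltnW (ltn_ord i))// exprS; ring.
have VS m : V m.+1 = V m + b m by rewrite /V big_ord_recr.
have E m : \sum_(i < m) b i * ((2 ^+ (m - i) - 1) * x + 1) = x * U m - (x - 1) * V m.
  by rewrite /U /V !mulr_sumr -sumrB; apply: eq_bigr => i _; ring.
move=> m; rewrite E.
have H0 : x * U 0%N - (x - 1) * V 0%N = 0 by rewrite /U /V !big_ord0; ring.
(* The recurrence has order two, so the induction carries two consecutive values. *)
suff: x * U m - (x - 1) * V m = (2 * m)%:R * b m /\
      x * U m.+1 - (x - 1) * V m.+1 = (2 * m.+1)%:R * b m.+1 by case.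
elim: m => [|m [IH1 IH2]].
  split; first by rewrite H0 mul0r.
  by rewrite b1 US VS b0 /U /V !big_ord0; ring.
split=> //; rewrite br.
(* The factors 3 and -2 come from [(t - 1)(t - 2) = t^2 - 3t + 2], whose roots are the multipliers
   in [VS] and [US]. *)
have -> : x * U m.+2 - (x - 1) * V m.+2 =
   3 * (x * U m.+1 - (x - 1) * V m.+1) - 2 * (x * U m - (x - 1) * V m)
   + (x + 1) * b m.+1 - 2 * b m.
  by rewrite !US !VS; ring.
by rewrite IH1 IH2 (natrD _ (6 * m)) (natrM _ 6) !(natrM _ 2) -!natr1 -muln2 natrM; ring.
Qed.
End Recurrences.

(** The algebraic half of the proof, free of integrals: only the closed form of the even moments
    enters, with [x] for the dimension. *)
Lemma spin_log_rec (R : numFieldType) (x : R) (c : nat -> R) :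
  (forall m, c m = \sum_(j < m.+1)
     'C(m.*2, j.*2)%:R * rising2 1 (m - j) * rising2 x j) ->
  fps_log (fps_even (fun m => c m / (2 ^+ m * m`!%:R))) =1
  fps_even (fun m : nat => if m == 0%N then 0
      else (2 * m)%N%:R^-1 * ((2 ^+ m - 1) * x + 1)).
Proof.
move=> cE.
have r0 j : rising2 1 j != 0 :> R by rewrite gt_eqF// rising2_gt0.
have f0 i : i`!%:R != 0 :> R by rewrite pnatr_eq0 -lt0n fact_gt0.
have t0 i : 2 ^+ i != 0 :> R by rewrite expf_neq0// pnatr_eq0.
pose q j := rising2 x j / rising2 1 j : R.
pose e m := rising2 1 m / (2 ^+ m * m`!%:R) : R.
have qS j : j.*2.+1%:R * q j.+1 = (x + j.*2%:R) * q j.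
  rewrite /q !rising2S invfM -natr1 [1 + _]addrC.
  have : j.*2%:R + 1 != 0 :> R by rewrite natr1 pnatr_eq0.
  by move: (r0 j) => ? ?; field; apply/andP.
set b := fun m => _.
have bE m : b m = e m * btrans q m.
  rewrite /b cE /btrans /e mulrAC; congr (_ / _); rewrite mulr_sumr; apply: eq_bigr => j _.
  rewrite mulrA -bin_double ?leq_ord// /q; move: (r0 j) => ?; by field.
have eS m : (2 * m.+1)%:R * e m.+1 = m.*2.+1%:R * e m.
  rewrite /e rising2S factS exprS !natrM [1 + _]addrC natr1.
  have : m.+1%:R != 0 :> R by rewrite pnatr_eq0.
  by move: (t0 m) (f0 m) => ? ? ?; field; rewrite f0 t0 addrC natr1.
have q0 : q 0%N = 1 by rewrite /q /rising2 !big_ord0 divr1.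
have e0 : e 0%N = 1 by rewrite /e /rising2 !big_ord0 expr0 !mulr1 divr1.
have b0 : b 0%N = 1.
  by rewrite bE e0 /btrans big_ord_recl big_ord0 /= bin0 q0 !mulr1 addr0 mulr1.
have b1 : 2 * b 1%N = x + 1.
  rewrite bE mulrA (eS 0%N) e0 /btrans 2!big_ord_recl big_ord0 /= bin0 q0.
  have := qS 0%N; rewrite q0 /= addr0 mul1r mulr1 /bump /= => ->.
  by rewrite double0; ring.
have br m : (2 * m.+2)%:R * b m.+2 =
     (x + (6 * m + 7)%:R) * b m.+1 - (2 * m.*2.+1)%:R * b m.
  (* Raising the index of [e] gives all terms the common factor [e m.+1], which leaves
     [btrans_rec]. *)
  have h : (2 * m.*2.+1)%:R * e m = (4 * m.+1)%:R * e m.+1.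
    by rewrite natrM -mulrA -eS mulrA -natrM mulnA.
  rewrite !bE (mulrA _ (e m)) h (mulrA _ (e m.+2)) eS doubleS mulrAC (btrans_rec m qS); ring.
apply: fps_log_even => //= m.
have two0 : 2 != 0 :> R by rewrite pnatr_eq0.
apply: (mulfI two0); rewrite mulrA -natrM -(log_deriv_of_recurrence b0 b1 br) mulr_sumr.
apply: eq_bigr => i _; have mi : (0 < m - i)%N by rewrite subn_gt0.
have : (m - i)%:R != 0 :> R by rewrite pnatr_eq0 -lt0n.
by rewrite gtn_eqF// natrM => ?; field.
Qed.

Import numFieldNormedType.Exports.
Local Open Scope classical_set_scope.

(** * Even moments of the one-dimensional Gaussian weight *)

Section GaussianMoments.
Context (R : realType).
Local Notation mu := (@lebesgue_measure R).

Definition gauss_weight (x : R) : R := expR (- (x ^+ 2 / 2)).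

Lemma measurable_gauss_weight : measurable_fun setT gauss_weight.
Proof.
apply: measurableT_comp => //; apply: measurableT_comp => //.
by apply: measurable_funM => //; exact: measurable_funX.
Qed.

(** Equals [sqrt(2 pi)]; the form as an inverse peak matches the normalisation of the normal
    density. *)
Definition gauss_mass : R := (normal_peak 1)^-1.

Lemma gauss_mass_gt0 : 0 < gauss_mass.
Proof. by rewrite invr_gt0 normal_peak_gt0. Qed.

Lemma integral_gauss_weight : (\int[mu]_x (gauss_weight x)%:E = gauss_mass%:E)%E.
Proof.
have pg : normal_peak 1 != 0 :> R by rewrite gt_eqF// normal_peak_gt0.
have gE x : normal_pdf 0 1 x = normal_peak 1 * gauss_weight x.
  by rewrite normal_pdfE ?oner_neq0// /normal_fun subr0 expr1n mulNr.
have : (\int[mu]_x (gauss_mass%:E * (normal_pdf 0 1 x)%:E) = gauss_mass%:E)%E.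
  rewrite ge0_integralZl ?integral_normal_pdf ?mule1//.
  - by apply/measurable_EFinP; exact: measurable_normal_pdf.
  - by move=> x _; rewrite lee_fin normal_pdf_ge0.
  - by rewrite lee_fin ltW ?gauss_mass_gt0.
move=> <-; apply: eq_integral => x _.
by rewrite -EFinM gE /gauss_mass mulKf.
Qed.

Lemma is_derive_gauss_weight (x : R) : is_derive x 1 gauss_weight (- x * gauss_weight x).
Proof.
have h : is_derive x 1 (fun y : R => - (y ^+ 2 / 2)) (- x).
  by apply: is_derive_eq; rewrite !scaler0 /GRing.scale /=; field.
have := @is_derive1_comp R expR _ x _ _ (is_derive_expR _) h.
by rewrite mulrC.
Qed.

Lemma is_derive_pow (a : nat) (x : R) :
  is_derive x 1 (fun y => y ^+ a.+1) (a.+1%:R * x ^+ a).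
Proof.
have := @is_deriveX R R^o id a.+1 x 1 1 (is_derive_id x 1).
by rewrite exprfctE /GRing.scale /= mulr1.
Qed.

Lemma continuous_gauss_weight : continuous gauss_weight.
Proof.
move=> x; apply: differentiable_continuous; apply/derivable1_diffP.
by have [] := is_derive_gauss_weight x.
Qed.

Lemma cvg_pow_gauss_weight (a : nat) :
  n.+1%:R ^+ a * gauss_weight n.+1%:R @[n --> \oo] --> (0 : R).
Proof.
(* One term of the exponential series suffices: for [y >= 1], [C * expR (y ^+ 2 / 2) >= y ^+ (2a +
   2) >= y ^+ a.+1]. *)
pose C : R := 2 ^+ a.+1 * a.+1`!%:R.
apply: (@squeeze_cvgr _ _ _ _ (fun=> 0) (fun n => C * harmonic n)).
- near=> n; rewrite mulr_ge0 ?exprn_ge0 ?expR_ge0//=.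
  have n0 : 0 < n.+1%:R :> R by [].
  have n1 : 1 <= n.+1%:R :> R by rewrite ler1n.
  move: (n.+1%:R : R) n0 n1 => y y0 y1.
  rewrite ler_pdivlMr// mulrAC -exprSr /gauss_weight expRN ler_pdivrMr ?expR_gt0//.
  have : 0 <= y ^+ 2 / 2 by rewrite divr_ge0// sqr_ge0.
  move=> /(@expR_ge1Dxn _ _ a) h.
  have {}h : (y ^+ 2 / 2) ^+ a.+1 / a.+1`!%:R <= expR (y ^+ 2 / 2).
    by rewrite (le_trans _ h)// lerDr.
  rewrite (@le_trans _ _ (C * ((y ^+ 2 / 2) ^+ a.+1 / a.+1`!%:R)))//; last first.
    by rewrite ler_wpM2l// mulr_ge0// exprn_ge0.
  rewrite /C expr_div_n mulrACA -[X in _ <= X]mulrA.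
  have f0 : a.+1`!%:R != 0 :> R by rewrite pnatr_eq0 -lt0n fact_gt0.
  have t0 : 2 ^+ a.+1 != 0 :> R by rewrite expf_neq0// pnatr_eq0.
  rewrite divff// mulr1 mulrC divfK// -exprM ler_weXn2l//.
  by rewrite mul2n -addnn leq_addr.
- exact: cvg_cst.
- rewrite -[X in _ --> X](mulr0 C); apply: cvgM; [exact: cvg_cst|exact: cvg_harmonic].
Unshelve. all: by end_near. Qed.

Let f (a : nat) (x : R) := x ^+ a.*2 * gauss_weight x.

Let f_ge0 a x : 0 <= f a x.
Proof. by rewrite mulr_ge0 ?expR_ge0// exprn_even_ge0// odd_double. Qed.

Let cf a : continuous (f a).
Proof.
by move=> x; apply: cvgM; [exact: exprn_continuous|exact: continuous_gauss_weight].
Qed.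

Let mf a : measurable_fun setT (f a).
Proof. exact: continuous_measurable_fun. Qed.

(** [- gauss_weight] is a primitive of [x * gauss_weight x], and the odd power vanishes at 0, so
    only the boundary term at [b] remains. *)
Let integral_parts a (b : R) : 0 < b ->
  (\int[mu]_(x in `[0%R, b]) (f a.+1 x)%:E =
  (a.*2.+1%:R)%:E * \int[mu]_(x in `[0%R, b]) (f a x)%:E
  - (b ^+ a.*2.+1 * gauss_weight b)%:E)%E.
Proof.
move=> b0.
have cwithin (h : R -> R) : continuous h -> {within `[0, b], continuous h}.
  exact: continuous_subspaceT.
have dLR (h h' : R -> R) : (forall x : R, is_derive x 1 h (h' x)) ->
    derivable_oo_LRcontinuous h 0 b.
  move=> dh; have ch : continuous h.
    move=> x; apply: differentiable_continuous; apply/derivable1_diffP.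
    by have [] := dh x.
  split; first by move=> x _; have [] := dh x.
  - by apply: cvg_at_right_filter; exact: ch.
  - by apply: cvg_at_left_filter; exact: ch.
have dF := @is_derive_pow a.*2.
have dG (x : R) : is_derive x 1 (- gauss_weight) (x * gauss_weight x).
  by have := is_deriveN (is_derive_gauss_weight x); rewrite mulNr opprK.
have := @integration_by_parts R (fun x => x ^+ a.*2.+1) (- gauss_weight)
  (fun x => a.*2.+1%:R * x ^+ a.*2) (fun x => x * gauss_weight x) 0 b b0.
move=> /(_ _ (dLR _ _ dF) _ _ (dLR _ _ dG) _) h.
transitivity (\int[mu]_(x in `[0%R, b]) (x ^+ a.*2.+1 * (x * gauss_weight x))%:E)%E.
  by apply: eq_integral => x _; rewrite /f doubleS mulrA -exprSr.
rewrite h.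
- rewrite expr0n /= mul0r subr0 addeC; congr (_ + _)%E; last first.
    by rewrite -mulrN.
  (* The sign is pulled out to leave a nonnegative integrand. *)
  transitivity (- \int[mu]_(x in `[0%R, b]) (- (a.*2.+1%:R%:E * (f a x)%:E)))%E.
    congr (- _)%E; apply: eq_integral => x _.
    by rewrite -EFinM /f mulrA -EFinN -mulrN.
  rewrite integral_ge0N ?oppeK; last first.
    by move=> x _; rewrite -EFinM lee_fin mulr_ge0// ?f_ge0.
  rewrite ge0_integralZl//.
  + by apply/measurable_EFinP; apply: measurable_funTS; exact: mf.
  + by move=> x _; rewrite lee_fin f_ge0.
- apply: cwithin => x; apply: cvgM; [exact: cvg_cst|exact: exprn_continuous].
- by move=> x _; rewrite derive1E; have [_ ->] := dF x.
- by apply: cwithin => x; apply: cvgM; [exact: cvg_id|exact: continuous_gauss_weight].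
- by move=> x _; rewrite derive1E; have [_ ->] := dG x.
Qed.

Let integral0y_rec a :
  (\int[mu]_(x in `[0%R, +oo[) (f a.+1 x)%:E =
  (a.*2.+1%:R)%:E * \int[mu]_(x in `[0%R, +oo[) (f a x)%:E)%E.
Proof.
have := @ge0_cvgn_integral R mu _ (f_ge0 a.+1) (mf a.+1).
have := @ge0_cvgn_integral R mu _ (f_ge0 a) (mf a).
(* The shift makes the upper bound [n.+1%:R] positive, as [integral_parts] requires. *)
rewrite -cvg_shiftS -[X in _ -> X -> _]cvg_shiftS /= => h1 h2.
have h3 : (\int[mu]_(x in `[0%R, n.+1%:R]) (f a.+1 x)%:E)%E @[n --> \oo] -->
    ((a.*2.+1%:R)%:E * \int[mu]_(x in `[0%R, +oo[) (f a x)%:E - 0%:E)%E; last first.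
  rewrite sube0 in h3; exact: (cvg_unique _ h2 h3).
under eq_cvg do rewrite integral_parts//.
apply: cvgeD => //.
- by rewrite fin_num_adde_defl.
- exact: cvgeZl.
- apply: cvgeN; apply: cvg_EFin; first exact: nearW.
  exact: cvg_pow_gauss_weight.
Qed.

(** Evenness doubles the half-line integrals, so their recursion, with factor [2a + 1], passes to
    the whole line. *)
Lemma gauss_moment a :
  (\int[mu]_x (x ^+ a.*2 * gauss_weight x)%:E = (gauss_mass * rising2 1 a)%:E)%E.
Proof.
have sym b : (\int[mu]_x (f b x)%:E =
    2%:E * \int[mu]_(x in `[0%R, +oo[) (f b x)%:E)%E.
  rewrite ge0_symfun_integralT ?set_itvcy//.
  by move=> x /=; rewrite /f /gauss_weight sqrrN -!mul2n !exprM sqrrN.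
elim: a => [|a IH].
  rewrite /rising2 big_ord0 mulr1 -integral_gauss_weight.
  by apply: eq_integral => x _; rewrite expr0 mul1r.
rewrite -/(f a.+1) sym integral0y_rec muleCA -sym IH rising2S -EFinM.
by rewrite -natr1; congr EFin; ring.
Qed.
End GaussianMoments.

(** Tonelli's theorem term by term. It serves both to add a coordinate to a tuple and to separate
    scalar from vector part in the spin factor. *)
Lemma ge0_integral_prod_sum (R : realType) d1 d2 (T1 : measurableType d1)
    (T2 : measurableType d2) (m1 : {sigma_finite_measure set T1 -> \bar R})
    (m2 : {sigma_finite_measure set T2 -> \bar R}) (k : nat)
    (c U V : 'I_k -> R) (u : 'I_k -> T1 -> R) (v : 'I_k -> T2 -> R) :
  (forall i, 0 <= c i) ->
  (forall i x, 0 <= u i x) -> (forall i y, 0 <= v i y) ->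
  (forall i, measurable_fun setT (u i)) ->
  (forall i, measurable_fun setT (v i)) ->
  (forall i, \int[m1]_x (u i x)%:E = (U i)%:E)%E ->
  (forall i, \int[m2]_y (v i y)%:E = (V i)%:E)%E ->
  (\int[m1 \x m2]_z (\sum_(i < k) c i * (u i z.1 * v i z.2))%:E =
   (\sum_(i < k) c i * (U i * V i))%:E)%E.
Proof.
move=> c0 u0 v0 mu mv uE vE.
have muv i : measurable_fun setT (fun z : T1 * T2 => u i z.1 * v i z.2).
  by apply: measurable_funM;
    [exact: measurableT_comp (mu i) _|exact: measurableT_comp (mv i) _].
under eq_integral do rewrite -sumEFin.
rewrite ge0_integral_sum//; last 2 first.
- by move=> i; apply/measurable_EFinP; exact: measurable_funM.
- by move=> i z _; rewrite lee_fin !mulr_ge0.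
rewrite -sumEFin; apply: eq_bigr => i _.
under eq_integral do rewrite EFinM.
rewrite ge0_integralZl//; last 3 first.
- by apply/measurable_EFinP.
- by move=> z _; rewrite lee_fin mulr_ge0.
- by rewrite lee_fin.
rewrite EFinM; congr (_ * _)%E.
rewrite fubini_tonelli1/=; last 2 first.
- exact/measurable_EFinP.
- by move=> z; rewrite lee_fin mulr_ge0.
rewrite /fubini_F /=.
under eq_integral => x _.
  under eq_integral do rewrite EFinM.
  rewrite ge0_integralZl//; last 3 first.
  - exact/measurable_EFinP.
  - by move=> y _; rewrite lee_fin.
  - by rewrite lee_fin.
  rewrite vE.
  over.
rewrite ge0_integralZr// ?uE ?EFinM//.
- exact/measurable_EFinP.
- by move=> x _; rewrite lee_fin.
- by rewrite -vE integral_ge0// => y _; rewrite lee_fin.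
Qed.

(** * Gaussian moments of the squared Euclidean norm *)

Section TupleMoments.
Context (R : realType).
Local Notation mR := (measurableTypeR R).

Definition sqnorm (n : nat) (t : n.-tuple mR) : R := \sum_(i < n) tnth t i ^+ 2.

Lemma sqnorm_ge0 n (t : n.-tuple mR) : 0 <= sqnorm t.
Proof. by apply: sumr_ge0 => i _; exact: sqr_ge0. Qed.

Lemma sqnorm_cons n (z : mR * n.-tuple mR) :
  sqnorm (tuple_cons z) = z.1 ^+ 2 + sqnorm z.2.
Proof.
rewrite /sqnorm big_ord_recl; congr (_ + _).
by apply: eq_bigr => i _; rewrite /tuple_cons tnthS.
Qed.

Lemma measurable_sqnorm n : measurable_fun setT (@sqnorm n).
Proof.
apply: measurable_sum => i; apply: measurable_funX; exact: measurable_tnth.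
Qed.

Definition tuple_weight (n : nat) (t : n.-tuple mR) : R := expR (- (sqnorm t / 2)).

Lemma measurable_sqnorm_weight n j :
  measurable_fun setT (fun t : n.-tuple mR => sqnorm t ^+ j * tuple_weight t).
Proof.
apply: measurable_funM; first by apply: measurable_funX; exact: measurable_sqnorm.
apply: measurableT_comp => //; apply: measurableT_comp => //.
by apply: measurable_funM => //; exact: measurable_sqnorm.
Qed.

Lemma weight_cons n (z : mR * n.-tuple mR) :
  tuple_weight (tuple_cons z) = gauss_weight z.1 * tuple_weight z.2.
Proof. by rewrite /tuple_weight /gauss_weight sqnorm_cons mulrDl opprD expRD. Qed.

Lemma measurable_pow_gauss_weight a :
  measurable_fun setT (fun x : mR => x ^+ a.*2 * gauss_weight x).
Proof. by apply: measurable_funM; [exact: measurable_funX|exact: measurable_gauss_weight]. Qed.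

Lemma pow_gauss_weight_ge0 a (x : R) : 0 <= x ^+ a.*2 * gauss_weight x.
Proof. by rewrite mulr_ge0 ?expR_ge0// exprn_even_ge0// odd_double. Qed.

Lemma sqnorm_weight_ge0 n j (t : n.-tuple mR) : 0 <= sqnorm t ^+ j * tuple_weight t.
Proof. by rewrite mulr_ge0 ?expR_ge0// exprn_ge0// sqnorm_ge0. Qed.

(** By induction on the dimension: [(x ^+ 2 + s) ^+ j] is expanded, the new coordinate is integrated
    by [gauss_moment], and [rising2D] resums. *)
Lemma sqnorm_moment n j :
  (\int[lebesgue_tuple R n]_t (sqnorm t ^+ j * tuple_weight t)%:E =
   (gauss_mass R ^+ n * rising2 n%:R j)%:E)%E.
Proof.
elim: n j => [|n IH] j.
  (* In dimension 0 the measure is a point mass where the norm is 0; likewise [rising2 0 j] is 1 for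
     [j = 0] and 0 otherwise. *)
  rewrite /= integral_dirac//; last first.
    by apply/measurable_EFinP; exact: measurable_sqnorm_weight.
  rewrite diracT mul1e /tuple_weight /sqnorm big_ord0 mul0r oppr0 expR0 mulr1.
  rewrite expr0 mul1r; case: j => [|j]; first by rewrite /rising2 big_ord0 expr0.
  by rewrite /rising2 big_ord_recl /= addr0 mul0r expr0n.
rewrite /= /lebesgue_tupleS ge0_integral_pushforward//; last 3 first.
- exact: measurable_tuple_cons.
- by apply/measurable_EFinP; exact: measurable_sqnorm_weight.
- by move=> t _; rewrite lee_fin sqnorm_weight_ge0.
rewrite preimage_setT.
under eq_integral => z _.
  rewrite /= sqnorm_cons weight_cons.
  rewrite (_ : _ * _ = \sum_(i < j.+1) 'C(j, i)%:R *
     ((z.1 ^+ (j - i).*2 * gauss_weight z.1) *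
      (sqnorm z.2 ^+ i * tuple_weight z.2))); last first.
    rewrite exprDn mulr_suml; apply: eq_bigr => i _.
    by rewrite -mul2n exprM -mulr_natl; ring.
  over.
rewrite (@ge0_integral_prod_sum R _ _ _ _ _ _ _ _
  (fun i : 'I_j.+1 => gauss_mass R * rising2 1 (j - i))
  (fun i : 'I_j.+1 => gauss_mass R ^+ n * rising2 n%:R i)
  (fun (i : 'I_j.+1) (x : mR) => x ^+ (j - i).*2 * gauss_weight x)
  (fun (i : 'I_j.+1) (t : n.-tuple mR) => sqnorm t ^+ i * tuple_weight t)).
- congr EFin; rewrite -natr1 rising2D mulr_sumr; apply: eq_bigr => i _.
  by rewrite exprS; ring.
- by move=> i.
- by move=> i x; exact: pow_gauss_weight_ge0.
- by move=> i t; exact: sqnorm_weight_ge0.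
- by move=> i; exact: measurable_pow_gauss_weight.
- by move=> i; exact: measurable_sqnorm_weight.
- by move=> i; exact: gauss_moment.
- by move=> i; exact: IH.
Qed.
End TupleMoments.

(** * Traces of powers in the spin factor and their means *)

Section SpinMoments.
Context (R : realType) (n : nat).
Local Notation mR := (measurableTypeR R).

Lemma spin_expS (x : spin R n) k : spin_exp x k.+1 = spin_mul x (spin_exp x k).
Proof. by case: k => [|k] //; rewrite spin_mulC spin_mul1x. Qed.

Lemma dotZ (a : R) (u v : 'rV[R]_n) : dot u (a *: v) = a * dot u v.
Proof. by rewrite mulr_sumr; apply: eq_bigr => i _; rewrite mxE mulrCA. Qed.

Lemma dot_ge0 (u : 'rV[R]_n) : 0 <= dot u u.
Proof. by apply: sumr_ge0 => i _; rewrite -expr2 sqr_ge0. Qed.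

(** Spectral form of the power: [x] has eigenvalues [x.1 + r] and [x.1 - r]. When [r = 0] the two
    equations do not determine [b], hence the existential. *)
Lemma spin_expE (x : spin R n) k (r := Num.sqrt (dot x.2 x.2)) :
  exists b, [/\ spin_exp x k = (spin_tr (spin_exp x k), b *: x.2),
    spin_tr (spin_exp x k) + r * b = (x.1 + r) ^+ k &
    spin_tr (spin_exp x k) - r * b = (x.1 - r) ^+ k].
Proof.
have rr : r ^+ 2 = dot x.2 x.2 by rewrite sqr_sqrtr// dot_ge0.
elim: k => [|k [b [e hp hm]]].
  by exists 0; rewrite scale0r mulr0 addr0 subr0 !expr0.
(* Read off the vector part of [spin_mul]. *)
exists (spin_tr (spin_exp x k) + x.1 * b).
rewrite /spin_tr in e hp hm *; rewrite spin_expS e /spin_mul /= dotZ -rr.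
split.
- by congr pair; rewrite scalerA -scalerDl addrC.
- by rewrite [in RHS]exprS -hp; ring.
- by rewrite [in RHS]exprS -hm; ring.
Qed.

Lemma spin_tr_exp_double (x : spin R n) m :
  spin_tr (spin_exp x m.*2) =
  \sum_(j < m.+1) 'C(m.*2, j.*2)%:R * (x.1 ^+ (m - j).*2 * dot x.2 x.2 ^+ j).
Proof.
have [b [_ hp hm]] := spin_expE x m.*2.
move: hp hm; set r := Num.sqrt _ => hp hm.
have rr : r ^+ 2 = dot x.2 x.2 by rewrite sqr_sqrtr// dot_ge0.
(* Twice the trace is the sum of the two spectral identities, in which [b] cancels. *)
apply: (@mulfI R 2); first by rewrite pnatr_eq0.
transitivity ((x.1 + r) ^+ m.*2 + (x.1 - r) ^+ m.*2).
  by rewrite -hp -hm; ring.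
rewrite !exprDn -big_split /=.
(* Of the [2m + 1] terms the last is set apart and the others are paired by parity; the odd powers
   of [r] cancel. *)
rewrite big_ord_recr /= (sum_double (fun i => x.1 ^+ (m.*2 - i) * r ^+ i *+ 'C(m.*2, i)
   + x.1 ^+ (m.*2 - i) * (- r) ^+ i *+ 'C(m.*2, i))).
rewrite [in RHS]big_ord_recr /= mulrDr mulr_sumr; congr (_ + _).
  apply: eq_bigr => j _; rewrite -doubleB -rr -exprM mul2n.
  rewrite [(- r) ^+ _.+1]exprS -!(mul2n j) !(exprM (- r)) sqrrN -exprM exprS.
  by ring.
rewrite -rr -exprM mul2n -!(mul2n m) !(exprM (- r)) sqrrN -exprM.
by rewrite !subnn double0; ring.
Qed.

Lemma dot_spin_coord (z : mR * n.-tuple mR) :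
  dot (spin_coord z).2 (spin_coord z).2 = sqnorm z.2.
Proof. by apply: eq_bigr => i _; rewrite !mxE. Qed.

(** The trace of the square is [x_0^2 + |v|^2], so the weight factors. *)
Lemma spin_weightE (z : mR * n.-tuple mR) :
  spin_weight (spin_coord z) = gauss_weight z.1 * tuple_weight z.2.
Proof.
by rewrite /spin_weight /spin_tr /= dot_spin_coord -expr2 mulrDl opprD expRD.
Qed.

Lemma spin_trace_moment m :
  spin_integral (fun x : spin R n => spin_tr (spin_exp x m.*2) * spin_weight x) =
  gauss_mass R ^+ n.+1 *
  \sum_(j < m.+1) 'C(m.*2, j.*2)%:R * rising2 1 (m - j) * rising2 n%:R j.
Proof.
rewrite /spin_integral /Rintegral /spin_lebesgue.
under eq_integral => z _.
  rewrite spin_tr_exp_double spin_weightE dot_spin_coord.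
  rewrite (_ : _ * _ = \sum_(i < m.+1) 'C(m.*2, i.*2)%:R *
     ((z.1 ^+ (m - i).*2 * gauss_weight z.1) *
      (sqnorm z.2 ^+ i * tuple_weight z.2))); last first.
    by rewrite mulr_suml; apply: eq_bigr => i _; rewrite /=; ring.
  over.
rewrite (@ge0_integral_prod_sum R _ _ _ _ _ _ _ _
  (fun i : 'I_m.+1 => gauss_mass R * rising2 1 (m - i))
  (fun i : 'I_m.+1 => gauss_mass R ^+ n * rising2 n%:R i)
  (fun (i : 'I_m.+1) (x : mR) => x ^+ (m - i).*2 * gauss_weight x)
  (fun (i : 'I_m.+1) (t : n.-tuple mR) => sqnorm t ^+ i * tuple_weight t)).
- rewrite /= mulr_sumr; apply: eq_bigr => i _.
  by rewrite exprS; ring.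
- by move=> i.
- by move=> i x; exact: pow_gauss_weight_ge0.
- by move=> i t; exact: sqnorm_weight_ge0.
- by move=> i; exact: measurable_pow_gauss_weight.
- by move=> i; exact: measurable_sqnorm_weight.
- by move=> i; exact: gauss_moment.
- by move=> i; exact: sqnorm_moment.
Qed.

Lemma spin_C_double m : spin_C R n m.*2 =
  \sum_(j < m.+1) 'C(m.*2, j.*2)%:R * rising2 1 (m - j) * rising2 n%:R j.
Proof.
rewrite /spin_C /spin_mean spin_trace_moment.
have -> : spin_integral (@spin_weight R n) = gauss_mass R ^+ n.+1.
  (* The normalising integral is the numerator at [m = 0], as [x^0] has trace 1. *)
  transitivity (spin_integral (fun x : spin R n =>
      spin_tr (spin_exp x 0.*2) * spin_weight x)).
    by congr spin_integral; apply/funext => x; rewrite mul1r.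
  by rewrite spin_trace_moment big_ord_recl big_ord0 /rising2 !big_ord0 bin0 addr0 !mulr1.
by rewrite mulrC mulKf// expf_neq0// gt_eqF// gauss_mass_gt0.
Qed.
End SpinMoments.

Theorem theorem7p5 (R : realType) (n : nat) (hn : (1 <= n)%N) :
  spin_Bc R n =1
    fps_even (fun m : nat =>
      if m == 0%N then 0
      else (2 * m)%N%:R^-1 * ((2 ^+ m - 1) * n%:R + 1)).
Proof.
apply: (@spin_log_rec R n%:R (fun m => spin_C R n m.*2)) => m.
exact: spin_C_double.
Qed.
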